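(* Let $(R_\alpha)$ be a regularization method for $F(x)=y$ in the deterministic setting such that, under a set of assumptions on the operator $F$, the solution $x^\dagger$ and the data (data satisfying these assumptions form the set $\mathcal{A}\subset\mathcal{Y}$) and under a suitable parameter choice rule $\alpha=\alpha(\delta)$ or $\alpha=\alpha(\delta,y^\delta)$, one has $$d_{\mathcal{X}}(x^\dagger,R_\alpha(y^\delta))\le\varphi(d_{\mathcal{Y}}(y,y^\delta))$$ for all $\delta>0$ and all $y^\delta\in\mathcal{A}$ with $d_{\mathcal{Y}}(y,y^\delta)\le\delta$, where $\varphi:[0,\infty)\to[0,\infty)$ is a monotonically increasing right-continuous function. For $\eta>0$ let $y^\eta=y+\epsilon(\eta)$, where $\epsilon(\eta)$ is a $\mathcal{Y}$-valued stochastic error such that, as $\eta\to 0$, a) $\rho_K(y,y^\eta)\to 0$, or b) $\mathbb{E}(d_{\mathcal{Y}}(y,y^\eta))\to 0$. Assume that all assumptions needed for the deterministic theory, except the bound on the noise, hold with probability one (in particular $y^\eta\in\mathcal{A}$ almost surely for every $\eta$) and that $x^\dagger$ is a (locally) unique solution of $F(x)=y$. Let $R_\alpha(y^\eta)$ be the regularized solution obtained with the same parameter choice rule as in the deterministic setting, with $\delta$ replaced by $\rho_K(y,y^\eta)$ in case a), and by $\tau(\eta)\mathbb{E}(d_{\mathcal{Y}}(y,y^\eta))$ in case b), where $\tau(\eta)>0$ fulfills $\tau(\eta)\to\infty$ as $\eta\to 0$ and $\lim_{\eta\to 0}\tau(\eta)\mathbb{E}(d_{\mathcal{Y}}(y,y^\eta))=0$.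 Then, as $\eta\to 0$, in case a) $$\rho_K(x^\dagger,R_\alpha(y^\eta))=\mathcal{O}\bigl(\max\{\varphi(\rho_K(y,y^\eta)),\ \rho_K(y,y^\eta)\}\bigr),$$ and in case b) $$\rho_K(x^\dagger,R_\alpha(y^\eta))=\mathcal{O}\Bigl(\max\bigl\{\varphi\bigl(\tau(\eta)\mathbb{E}(d_{\mathcal{Y}}(y,y^\eta))\bigr),\ \mathbb{P}\bigl(d_{\mathcal{Y}}(y,y^\eta)\ge\tau(\eta)\mathbb{E}(d_{\mathcal{Y}}(y,y^\eta))\bigr)\bigr\}\Bigr).$$
   Context: Setting. $\mathcal{X},\mathcal{Y}$ are Banach (or Hilbert) spaces with metrics $d_{\mathcal{X}},d_{\mathcal{Y}}$ (typically induced by the norms), $F:\mathcal{D}(F)\subset\mathcal{X}\to\mathcal{Y}$ is a (in general nonlinear) operator, and $y\in\mathcal{Y}$ is the exact data. $F$, $y$ and $x^\dagger$ are deterministic. $(\Omega,\mathcal{F},\mathbb{P})$ is a complete probability space; all random quantities are defined on it, and all maps whose probabilities or expectations are taken are assumed measurable. Ky Fan metric. For random variables $X_1,X_2$ with values in a metric space $(\chi,d_\chi)$, $\rho_K(X_1,X_2):=\inf\{\varepsilon>0:\mathbb{P}(d_\chi(X_1,X_2)>\varepsilon)<\varepsilon\}$; deterministic elements are viewed as constant random variables. Regularization method. This consists of (possibly nonlinear) maps $R_\alpha:\mathcal{D}(R_\alpha)\subset\mathcal{Y}\to\mathcal{X}$, $\alpha>0$, with a parameter choice rule assigning to each noise level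 $\delta>0$ and data $y^\delta$ a value $\alpha=\alpha(\delta)$ (a priori) or $\alpha=\alpha(\delta,y^\delta)$ (a posteriori), such that $R_\alpha(y^\delta)\to x^\dagger$ as $\delta\to0$ for data $y^\delta\in\mathcal{A}$ with $d_{\mathcal{Y}}(y,y^\delta)\le\delta$; $R_\alpha(y^\delta)$ is defined for $y^\delta\in\mathcal{A}$ and the chosen $\alpha$. The value substituted for $\delta$ in the rule is understood to be positive. ''Locally unique'' means that $x^\dagger$ is the only solution of $F(x)=y$ in some neighbourhood of $x^\dagger$. *)

(* Defs.v *)
From HB Require Import structures.
From mathcomp Require Import all_boot all_order all_algebra.
From mathcomp Require Import all_classical all_reals all_analysis.
Set Implicit Arguments.
Unset Strict Implicit.
Unset Printing Implicit Defensive.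
Import Order.TTheory GRing.Theory Num.Theory.
Import numFieldNormedType.Exports.
Local Open Scope classical_set_scope.
Local Open Scope ring_scope.

(* The metrics on the Banach spaces need not be the ones induced by the norms,
   so they are explicit functions rather than the library's [mdist]; all the
   topological notions below refer to them. *)
Definition is_metric (R : realType) (E : Type) (dist : E -> E -> R) : Prop :=
  [/\ forall u v, 0 <= dist u v,
      forall u v, dist u v = 0 <-> u = v,
      forall u v, dist u v = dist v u
    & forall u v w, dist u w <= dist u v + dist v w].

Definition metric_open (R : realType) (E : Type) (dist : E -> E -> R)
    (U : set E) : Prop :=
  forall u, U u -> exists2 r : R, 0 < r & forall v, dist u v < r -> U v.

(* [g_sigma_algebraType G] is the carrier E with the sigma-algebra <<s G >>,
   here the Borel sigma-algebra of (E, dist). *)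
Definition random_element (d : measure_display) (T : measurableType d)
    (R : realType) (E : pointedType) (dist : E -> E -> R) (X : T -> E) : Prop :=
  measurable_fun [set: T]
    (X : T -> g_sigma_algebraType (metric_open dist : set (set E))).

(* The set contains every eps > 1 and is bounded below by 0, so that [inf] is
   the true infimum. *)
Definition ky_fan (d : measure_display) (T : measurableType d) (R : realType)
    (P : probability T R) (E : Type) (dist : E -> E -> R) (X1 X2 : T -> E) : R :=
  inf [set eps : R | 0 < eps /\
    (P [set w | (eps < dist (X1 w) (X2 w))%R] < eps%:E)%E].

Definition locally_unique_solution (R : realType) (E G : Type)
    (dist : E -> E -> R) (DF : set E) (F : E -> G) (y : G) (x : E) : Prop :=
  [/\ DF x, F x = y
    & exists2 r : R, 0 < r &
        forall z, DF z -> dist x z < r -> F z = y -> z = x].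

(* Partial maps are total functions together with a domain: [DReg a] is the
   domain of [Reg a].  The rule [alpha delta yd] covers both kinds of choice;
   an a priori rule ignores its second argument. *)
Definition regularization_method (R : realType) (E G : Type)
    (dE : E -> E -> R) (dG : G -> G -> R) (y : G) (x : E) (A : set G)
    (DReg : R -> set G) (Reg : R -> G -> E) (alpha : R -> G -> R) : Prop :=
  [/\ forall delta yd, 0 < delta -> A yd -> 0 < alpha delta yd,
      forall delta yd, 0 < delta -> A yd -> DReg (alpha delta yd) yd
    & forall yd : R -> G,
        (forall delta, 0 < delta ->
           A (yd delta) /\ dG y (yd delta) <= delta) ->
        dE (Reg (alpha delta (yd delta)) (yd delta)) x @[delta --> 0^'+] --> 0].

Definition increasing_right_continuous (R : realType) (phi : R -> R) : Prop :=
  [/\ forall t, 0 <= t -> 0 <= phi t,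
      forall s t, 0 <= s -> s <= t -> phi s <= phi t
    & forall t, 0 <= t -> phi u @[u --> t^'+] --> phi t].

(* Main.v *)
Require Import Defs.
From HB Require Import structures.
From mathcomp Require Import all_boot all_order all_algebra.
From mathcomp Require Import all_classical all_reals all_analysis.
Import Order.TTheory GRing.Theory Num.Theory.
Import numFieldNormedType.Exports.
Local Open Scope classical_set_scope.
Local Open Scope ring_scope.

(** Why the rates hold: a large reconstruction error forces a large data error.
    Off the null set where the data leave the admissible class, [dY y y^eta <= t]
    with [t] the value fed to the parameter choice rule gives
    [dX xdag xreg <= phi (dY y y^eta) <= phi t] by the deterministic rate and the
    monotonicity of [phi].  Hence the event [phi t < dX xdag xreg] has at most the
    probability [p] of the data error exceeding [t] (reaching [t], in case b)),
    by [measure_error_gt_le], and the Ky Fan distance, which balances an error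
    level against the probability of exceeding it, is at most [max (phi t) p]
    ([ky_fan_rate_transfer]).

    In case a), [t] is the Ky Fan distance [rho] of the data, and [p <= rho]
    because the infimum that defines [rho] satisfies its own constraint in the
    weak form [P (rho < dY y y^eta) <= rho] ([measure_gt_ky_fan]).  In case b),
    [t] is [tau eta] times the mean error and [p] is itself the second term of
    the bound.  Both estimates hold with the constant 1; in case b) they hold for
    those [eta] at which that [t] is finite, which is the case near 0. *)

Lemma measurable_gt (d : measure_display) (T : measurableType d)
    (R : realType) (f : T -> R) (s : R) :
  measurable_fun [set: T] f -> measurable [set w | s < f w].
Proof.
move=> mf; rewrite -[X in measurable X]setTI.
have -> : [set w | s < f w] = f @^-1` `]s, +oo[.
  by rewrite set_itvoy.
exact: mf.
Qed.

Lemma ky_fan_has_inf (d : measure_display) (T : measurableType d)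
    (R : realType) (P : probability T R) (D : T -> R) :
  measurable_fun [set: T] D ->
  has_inf [set eps : R | 0 < eps /\ (P [set w | (eps < D w)%R] < eps%:E)%E].
Proof.
move=> mD; split; last by exists 0 => x [/ltW].
exists 2; split => //; apply: (@le_lt_trans _ _ 1%E); last by rewrite lte1n.
by apply: probability_le1; exact: measurable_gt.
Qed.

Lemma ky_fan_ge0 (d : measure_display) (T : measurableType d) (R : realType)
    (P : probability T R) (E : Type) (dist : E -> E -> R) (X1 X2 : T -> E) :
  measurable_fun [set: T] (fun w => dist (X1 w) (X2 w)) ->
  0 <= ky_fan P dist X1 X2.
Proof.
move=> /(ky_fan_has_inf _ _ _ P)[ne _].
by apply: lb_le_inf => // e [/ltW].
Qed.

(** The bound may be attained with a weak inequality only, so every [e > M], and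
    not [M] itself, is admissible in the infimum. *)
Lemma ky_fan_le (d : measure_display) (T : measurableType d) (R : realType)
    (P : probability T R) (E : Type) (dist : E -> E -> R) (X1 X2 : T -> E)
    (M : R) :
  measurable_fun [set: T] (fun w => dist (X1 w) (X2 w)) -> 0 <= M ->
  (P [set w | (M < dist (X1 w) (X2 w))%R] <= M%:E)%E ->
  ky_fan P dist X1 X2 <= M.
Proof.
move=> mD M0 PM; apply/ler_addgt0Pr => e e0.
apply: ge_inf; first by exists 0 => x [/ltW].
have Me : M < M + e by rewrite ltrDl.
split; first exact: le_lt_trans Me.
apply: (@le_lt_trans _ _ M%:E); last by rewrite lte_fin.
apply: le_trans PM; apply: le_measure; rewrite ?inE.
- exact: measurable_gt.
- exact: measurable_gt.
- by move=> w /= /(lt_trans Me).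
Qed.

(** Each [s] above the infimum dominates admissible [e] arbitrarily close to the
    infimum, and [P (s < dist) <= P (e < dist) < e]; the event at the infimum is
    the increasing union of the events at such [s]. *)
Lemma measure_gt_ky_fan (d : measure_display) (T : measurableType d)
    (R : realType) (P : probability T R) (E : Type) (dist : E -> E -> R)
    (X1 X2 : T -> E) :
  measurable_fun [set: T] (fun w => dist (X1 w) (X2 w)) ->
  (P [set w | (ky_fan P dist X1 X2 < dist (X1 w) (X2 w))%R]
     <= (ky_fan P dist X1 X2)%:E)%E.
Proof.
move=> mD; set D := fun w => dist (X1 w) (X2 w); set rho := ky_fan _ _ _ _.
have Ps s : rho < s -> (P [set w | (s < D w)%R] <= rho%:E)%E.
  move=> rs; apply/lee_addgt0Pr => e e0.
  have m0 : 0 < Num.min (s - rho) e by rewrite lt_min subr_gt0 rs.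
  have [x [x0 Px]] := inf_adherent m0 (ky_fan_has_inf _ _ _ P _ mD).
  rewrite -/(ky_fan P dist X1 X2) -/rho -ltrBlDl lt_min !ltrBlDl.
  rewrite addrC subrK => /andP[xs xe].
  apply: (@le_trans _ _ x%:E); last by rewrite -EFinD lee_fin ltW.
  apply: le_trans (ltW Px); apply: le_measure; rewrite ?inE.
  - exact: measurable_gt.
  - exact: measurable_gt.
  - by move=> w /=; exact: lt_trans.
(* Continuity from below carries the bound from the levels s > rho to rho. *)
pose F n := [set w | rho + n.+1%:R^-1 < D w].
have FE : [set w | rho < D w] = \bigcup_n F n.
  apply/seteqP; split => w /=.
    by move=> /ltr_add_invr[k hk]; exists k.
  by case=> n _; apply: lt_trans; rewrite ltrDl invr_gt0.
have cF : P (F n) @[n --> \oo] --> P (\bigcup_n F n).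
  apply: nondecreasing_cvg_mu.
  - by move=> n; exact: measurable_gt.
  - by rewrite -FE; exact: measurable_gt.
  - move=> n m nm; apply/subsetPset => w /=; apply: le_lt_trans.
    by rewrite lerD2l lef_pV2 ?posrE// ler_nat.
rewrite FE -(cvg_lim _ cF)//; apply: lime_le; first by apply/cvg_ex; eexists; exact: cF.
by apply: nearW => n; apply: Ps; rewrite ltrDl invr_gt0.
Qed.

Lemma measure_error_gt_le (d : measure_display) (T : measurableType d)
    (R : realType) (P : probability T R) (e : T -> R) (c : R) (B : set T) :
  measurable_fun [set: T] e -> measurable B ->
  {ae P, forall w, ~ B w -> e w <= c} ->
  (P [set w | (c < e w)%R] <= P B)%E.
Proof.
move=> me mB [N [mN PN NA]].
rewrite -[leRHS]adde0 -PN; apply: le_trans (measureU2 P mB mN).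
apply: le_measure; rewrite ?inE; [exact: measurable_gt|exact: measurableU|].
move=> w /= cw; have [|nB] := pselect (B w); [by left|right].
by apply: NA => /= /(_ nB); rewrite leNgt cw.
Qed.

(** A deterministic rate [phi] for data errors up to [t] carries over to the Ky
    Fan metric, at the price of the probability of the event [B] on which the
    data error may exceed [t]. *)
Lemma ky_fan_rate_transfer (d : measure_display) (T : measurableType d)
    (R : realType) (P : probability T R) (E : Type) (dist : E -> E -> R)
    (X1 X2 : T -> E) (D : T -> R) (A B : set T) (phi : R -> R) (t M : R) :
  measurable_fun [set: T] (fun w => dist (X1 w) (X2 w)) ->
  increasing_right_continuous phi -> (forall w, 0 <= D w) -> 0 <= t ->
  {ae P, forall w, A w} ->
  (forall w, A w -> D w <= t -> dist (X1 w) (X2 w) <= phi (D w)) ->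
  measurable B -> (forall w, ~ B w -> D w <= t) ->
  phi t <= M -> (P B <= M%:E)%E ->
  ky_fan P dist X1 X2 <= M.
Proof.
move=> mD [phi0 phi_incr _] D0 t0 aeA rate mB Bt phiM PM.
apply: ky_fan_le => //; first exact: le_trans (phi0 _ t0) phiM.
apply: le_trans PM; apply: measure_error_gt_le => //.
apply: filterS aeA => w Aw /Bt Dt.
by apply: le_trans (rate _ Aw Dt) _; apply: le_trans phiM; exact: phi_incr.
Qed.

Theorem theorem3p5
  (R : realType)
  (d : measure_display) (T : measurableType d) (P : probability T R)
  (Pcomplete : measure_is_complete P)
  (X Y : completeNormedModType R)
  (dX : X -> X -> R) (dY : Y -> Y -> R)
  (dX_metric : is_metric dX) (dY_metric : is_metric dY)
  (DF : set X) (F : X -> Y) (y : Y) (xdag : X)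
  (xdag_sol : locally_unique_solution dX DF F y xdag)
  (A : set Y) (DReg : R -> set Y) (Reg : R -> Y -> X) (alpha : R -> Y -> R)
  (Reg_method : regularization_method dX dY y xdag A DReg Reg alpha)
  (phi : R -> R) (phi_mono : increasing_right_continuous phi)
  (rate : forall (delta : R) (yd : Y), 0 < delta -> A yd ->
     dY y yd <= delta ->
     dX xdag (Reg (alpha delta yd) yd) <= phi (dY y yd))
  (noise : R -> T -> Y)
  (noise_rv : forall eta : R, 0 < eta -> random_element dY (noise eta))
  (yeta : R -> T -> Y)
  (yetaE : forall (eta : R) (w : T), 0 < eta -> yeta eta w = y + noise eta w)
  (dist_meas : forall eta : R, 0 < eta ->
     measurable_fun [set: T] (fun w => dY y (yeta eta w)))
  (yeta_A : forall eta : R, 0 < eta -> {ae P, forall w, A (yeta eta w)}) :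
  (* case a) *)
  (let rho := fun eta : R => ky_fan P dY (cst y) (yeta eta) in
   let xreg := fun (eta : R) (w : T) =>
     Reg (alpha (rho eta) (yeta eta w)) (yeta eta w) in
   (forall eta : R, 0 < eta -> 0 < rho eta) ->
   (forall eta : R, 0 < eta ->
      measurable_fun [set: T] (fun w => dX xdag (xreg eta w))) ->
   rho eta @[eta --> 0^'+] --> 0 ->
   (fun eta : R => ky_fan P dX (cst xdag) (xreg eta))
     =O_ (0^'+) (fun eta : R => Num.max (phi (rho eta)) (rho eta)))
  /\
  (* case b) *)
  (forall tau : R -> R,
   let mean := fun eta : R => ('E_P[fun w => dY y (yeta eta w)])%E in
   let level := fun eta : R => ((tau eta)%:E * mean eta)%E in
   let xreg := fun (eta : R) (w : T) =>
     Reg (alpha (fine (level eta)) (yeta eta w)) (yeta eta w) in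
   (forall eta : R, 0 < eta -> 0 < tau eta) ->
   (forall eta : R, 0 < eta -> (0 < level eta)%E) ->
   (forall eta : R, 0 < eta ->
      measurable_fun [set: T] (fun w => dX xdag (xreg eta w))) ->
   mean eta @[eta --> 0^'+] --> 0%E ->
   tau eta @[eta --> 0^'+] --> +oo ->
   level eta @[eta --> 0^'+] --> 0%E ->
   (fun eta : R => ky_fan P dX (cst xdag) (xreg eta))
     =O_ (0^'+) (fun eta : R =>
       Num.max (phi (fine (level eta)))
         (fine (P [set w | (level eta <= (dY y (yeta eta w))%:E)%E])))).

Proof.
have dY0 u v : 0 <= dY u v by case: dY_metric.
split.
- move=> rho xreg rho0 mX _; apply/eqO_exP; exists 1 => //.
  near=> eta; have eta0 : 0 < eta by near: eta; exact: nbhs_right_gt.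
  rewrite mul1r ger0_norm; last exact/ky_fan_ge0/mX.
  apply: le_trans (ler_norm _).
  apply: (@ky_fan_rate_transfer _ _ _ P _ dX _ _ (fun w => dY y (yeta eta w))
    (fun w => A (yeta eta w)) [set w | rho eta < dY y (yeta eta w)]
    phi (rho eta)) => //.
  + exact: mX.
  + exact/ltW/rho0.
  + exact: yeta_A.
  + by move=> w Aw; apply: rate => //; exact: rho0.
  + exact/measurable_gt/dist_meas.
  + by move=> w /negP; rewrite -leNgt.
  + by rewrite le_max lexx.
  + apply: (le_trans (measure_gt_ky_fan _ _ _ _ _ _ _ _ _)); first exact: dist_meas.
    by rewrite lee_fin le_max lexx orbT.
- move=> tau mean level xreg tau0 level0 mX _ _ level_cvg.
  apply/eqO_exP; exists 1 => //.
  near=> eta; have eta0 : 0 < eta by near: eta; exact: nbhs_right_gt.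
  (* An infinite level would be read as 0 by [fine], and the rule would then
     be fed a value that does not bound the data error. *)
  have finl : level eta \is a fin_num.
    by near: eta; have /fine_cvgP[] := level_cvg.
  have finlE : level eta = (fine (level eta))%:E by rewrite fineK.
  have l0 : 0 < fine (level eta) by rewrite -lte_fin -finlE; exact: level0.
  have mB : measurable [set w | (level eta <= (dY y (yeta eta w))%:E)%E].
    have -> : [set w | (level eta <= (dY y (yeta eta w))%:E)%E] =
        (fun w => dY y (yeta eta w)) @^-1` `[fine (level eta), +oo[.
      by rewrite finlE set_itvcy; apply/seteqP; split => w /=; rewrite lee_fin.
    by rewrite -[X in measurable X]setTI; exact: dist_meas.
  rewrite mul1r ger0_norm; last exact/ky_fan_ge0/mX.
  apply: le_trans (ler_norm _).
  apply: (@ky_fan_rate_transfer _ _ _ P _ dX _ _ (fun w => dY y (yeta eta w))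
    (fun w => A (yeta eta w)) _ phi (fine (level eta))) => //.
  + exact: mX.
  + exact: ltW.
  + exact: yeta_A.
  + by move=> w Aw; apply: rate.
  + exact: mB.
  + by move=> w /= /negP; rewrite -ltNge finlE lte_fin => /ltW.
  + by rewrite le_max lexx.
  + rewrite -[leLHS]fineK ?fin_num_measure//.
    by rewrite lee_fin le_max lexx orbT.
Unshelve. all: by end_near. Qed.
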